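(* Let $\mathcal{H}$ be a separable complex Hilbert space, let $\Lambda=\{\Lambda_i\}_{i\in J}$, $\Lambda_i\in\mathcal{L}(\mathcal{H},\mathcal{H}_i)$, be a g-frame for $\mathcal{H}$ with upper g-frame bound $B_\Lambda$, and let $\Lambda^d=\{\Lambda^d_i\}_{i\in J}$ be a dual g-frame of $\Lambda$ with upper g-frame bound $B_{\Lambda^d}$. Let $0\le\lambda<\frac{1}{\sqrt{B_\Lambda B_{\Lambda^d}}}\ (\le1)$ and let $(m_i)_{i\in J}$ be such that $1-\lambda\le m_i\le1+\lambda$ for all $i\in J$. Then $M_{m,\Lambda,\Lambda^d}$ and $M_{m,\Lambda^d,\Lambda}$ are invertible on $\mathcal{H}$, $$\frac{1}{1+\lambda\sqrt{B_\Lambda B_{\Lambda^d}}}\|h\|\le\|M^{-1}_{m,\Lambda,\Lambda^d}h\|\le\frac{1}{1-\lambda\sqrt{B_\Lambda B_{\Lambda^d}}}\|h\|\quad\text{for all }h\in\mathcal{H},$$ and the same inequalities hold for $\|M^{-1}_{m,\Lambda^d,\Lambda}h\|$. Moreover, $$M^{-1}_{m,\Lambda,\Lambda^d}=\sum_{k=0}^{\infty}(M_{m',\Lambda,\Lambda^d})^k\quad\text{and}\quad M^{-1}_{m,\Lambda^d,\Lambda}=\sum_{k=0}^{\infty}(M_{m',\Lambda^d,\Lambda})^k,$$ where $m'=(1-m_i)_{i\in J}$.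
   Context: $J\subseteq\mathbb{Z}$ is an index set, $\{\mathcal{H}_i\}_{i\in J}$ is a sequence of separable complex Hilbert spaces, and $\mathcal{L}(\mathcal{H},\mathcal{H}_i)$ is the set of bounded linear operators $\mathcal{H}\to\mathcal{H}_i$. A family $\{\Lambda_i\}_{i\in J}$, $\Lambda_i\in\mathcal{L}(\mathcal{H},\mathcal{H}_i)$, is a g-frame for $\mathcal{H}$ with lower and upper bounds $A,B>0$ if $A\|f\|^2\le\sum_{i\in J}\|\Lambda_if\|^2\le B\|f\|^2$ for all $f\in\mathcal{H}$. A g-frame $\{\Lambda^d_i\}_{i\in J}$ (with respect to the same $\{\mathcal{H}_i\}$) is a dual g-frame of $\{\Lambda_i\}_{i\in J}$ if $f=\sum_{i\in J}\Lambda_i^{\star}\Lambda^d_if=\sum_{i\in J}(\Lambda^d_i)^{\star}\Lambda_if$ for all $f\in\mathcal{H}$. For a scalar sequence $m$ the multiplier is $M_{m,\Lambda,\Theta}f=\sum_{i\in J}m_i\Lambda_i^{\star}\Theta_if$. *)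

(* Defs.v *)
From HB Require Import structures.
From mathcomp Require Import all_boot all_order all_algebra sesquilinear.
From mathcomp Require Import finmap complex.
From mathcomp Require Import all_classical all_reals all_analysis.
From mathcomp.analysis.showcase Require Import summability.

Set Implicit Arguments.
Unset Strict Implicit.
Unset Printing Implicit Defensive.

Import Order.TTheory GRing.Theory Num.Theory.

Local Open Scope classical_set_scope.
Local Open Scope complex_scope.
Local Open Scope ring_scope.

(* Norms of normed R[i]-modules take their (real) values in R[i]; [rnorm] is
   the same norm read in R. *)
Definition rnorm (R : realType) (V : normedModType R[i]) (x : V) : R :=
  complex.Re `|x|.

(* The inner product is linear in its first argument and conjugate-linear in
   the second one. *)
HB.mixin Record CompleteNormedModule_isHilbert (R : realType) H
    & CompleteNormedModule R[i] H := {
  inner : {dot H for (Num.conj : R[i] -> R[i])} ;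
  inner_norm : forall x : H, inner x x = `|x| ^+ 2 }.

#[short(type="hilbertType")]
HB.structure Definition Hilbert (R : realType) :=
  { H of CompleteNormedModule R[i] H & CompleteNormedModule_isHilbert R H }.

Definition separable (T : topologicalType) :=
  exists2 D : set T, countable D & dense D.

HB.mixin Record isBoundedOp (R : realType) (V W : normedModType R[i])
    (f : V -> W) := {
  bounded_op : exists c : R, forall x, rnorm (f x) <= c * rnorm x }.

#[short(type="boundedOp")]
HB.structure Definition BoundedOp (R : realType) (V W : normedModType R[i]) :=
  { f of @GRing.Linear R[i] V W *:%R f & isBoundedOp R V W f }.

Notation "''L' ( V , W )" := (boundedOp V W)
  (at level 8, format "''L' ( V ,  W )") : type_scope.

(* Operator norm, as an extended real so that it is meaningful for every
   function. *)
Definition opnorm (R : realType) (V W : normedModType R[i]) (f : V -> W)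
    : \bar R :=
  ereal_sup [set (rnorm (f x))%:E | x in [set x : V | rnorm x <= 1]].

(* [adjoint L y] is the vector x, given by Riesz representation, such that
   <L f, y> = <f, x> for all f. *)
Definition adjoint (R : realType) (H K : hilbertType R) (L : H -> K) (y : K)
    : H :=
  xget 0 [set x : H | forall f : H, inner (L f) y = inner f x].

Section gframes.
Variables (R : realType) (H : hilbertType R) (J : set int).
Variable K : J -> hilbertType R.
Implicit Types (L T : forall i : J, 'L(H, K i)) (m : J -> R[i]).

Definition gframe (A B : R) L :=
  [/\ 0 < A, 0 < B
    & forall f : H,
        ((A * rnorm f ^+ 2)%:E <= \esum_(i in [set: J]) (rnorm (L i f) ^+ 2)%:E
          <= (B * rnorm f ^+ 2)%:E)%E].

(* Series indexed by J are sums along the net of finite subsets of J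
   (unconditional convergence). *)
Definition has_sum (F : J -> H) (s : H) := partial_sum F @ totally --> s.

Definition dual_gframe L T :=
  (exists A B : R, gframe A B T) /\
  forall f : H, has_sum (fun i => adjoint (L i) (T i f)) f
             /\ has_sum (fun i => adjoint (T i) (L i f)) f.

Definition multiplier_term m L T (f : H) (i : J) : H :=
  m i *: adjoint (L i) (T i f).

(* [summability.sum] takes an arbitrary value when the series diverges;
   [multiplier_cvg] says that it never does. *)
Definition multiplier m L T (f : H) : H := sum (multiplier_term m L T f).

Definition multiplier_cvg m L T :=
  forall f : H, cvg (partial_sum (multiplier_term m L T f) @ totally).

End gframes.

(* M is a bounded operator which is invertible in L(H), with inverse N. *)
Definition inverse_op (R : realType) (H : hilbertType R) (M : H -> H)
    (N : 'L(H, H)) :=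
  [/\ exists T : 'L(H, H), M =1 T, cancel M N & cancel N M].

(* N = \sum_(k >= 0) P^k, with convergence in operator norm. *)
Definition neumann_series (R : realType) (H : hilbertType R) (P N : H -> H) :=
  opnorm (fun h => N h - \sum_(0 <= k < n) iter k P h) @[n --> \oo] --> 0%E.

(* Main.v *)
(* The dual frame identity says that the multiplier with constant symbol 1 is
   the identity, so M_{m,L,Ld} = Id - P with P = M_{m',L,Ld} and |m'_i| <= lam.
   For a finite sum g of terms c_i L_i^* T_i f with |c_i| <= mu, expanding
   |g|^2 = \sum_i Re <c_i T_i f, L_i g> and using the Bessel bound B of L at g
   gives |g|^2 <= mu^2 B \sum_i |T_i f|^2.  Applied to tails this makes the
   partial sums a Cauchy net, and in the limit it bounds the multiplier by
   mu sqrt(B D).  Hence |P| <= lam sqrt(B D) < 1, and Id - P is inverted by its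
   Neumann series.  Computations are done with the real inner product
   Re <x, y>; adjoints exist by the Riesz representation theorem. *)
Require Import Defs.
From HB Require Import structures.
From mathcomp Require Import all_boot all_order all_algebra sesquilinear.
From mathcomp Require Import finmap complex ring lra.
From mathcomp Require Import all_classical all_reals all_analysis.
From mathcomp.analysis.showcase Require Import summability.

Set Implicit Arguments.
Unset Strict Implicit.
Unset Printing Implicit Defensive.

Import Order.TTheory GRing.Theory Num.Theory.

Local Open Scope classical_set_scope.
Local Open Scope complex_scope.
Local Open Scope ring_scope.

(** * Norms, limits and Cauchy filters with real-valued norms *)

Section RealNorm.
Variables (R : realType) (V : normedModType R[i]).
Implicit Types (x y : V) (a : R[i]) (t : R).

Lemma rnormE x : `|x| = (rnorm x)%:C.
Proof. by rewrite /rnorm RRe_real// normr_real. Qed.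

Lemma rnorm_ge0 x : 0 <= rnorm x.
Proof. by rewrite -ler0c -rnormE. Qed.

Lemma rnorm0 : rnorm (0 : V) = 0.
Proof. by rewrite /rnorm normr0. Qed.

Lemma rnorm_eq0 x : rnorm x = 0 -> x = 0.
Proof. by move=> x0; apply/eqP; rewrite -normr_eq0 rnormE x0. Qed.

Lemma rnormN x : rnorm (- x) = rnorm x.
Proof. by rewrite /rnorm normrN. Qed.

Lemma rnormC x y : rnorm (x - y) = rnorm (y - x).
Proof. by rewrite -rnormN opprB. Qed.

Lemma rnormZ a x : rnorm (a *: x) = complex.Re `|a| * rnorm x.
Proof.
rewrite /rnorm normrZ -{1}(RRe_real (normr_real a)) -{1}(RRe_real (normr_real x)).
by rewrite -rmorphM.
Qed.

Lemma ler_rnormD x y : rnorm (x + y) <= rnorm x + rnorm y.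
Proof. by rewrite -lecR rmorphD/= -!rnormE ler_normD. Qed.

Lemma ler_rnormB x y : rnorm (x - y) <= rnorm x + rnorm y.
Proof. by rewrite (le_trans (ler_rnormD _ _))// rnormN. Qed.

Lemma cvg_rnormP (T : Type) (F : set_system T) {FF : Filter F}
    (f : T -> V) (y : V) :
  f @ F --> y <-> forall e : R, 0 < e -> \forall t \near F, rnorm (y - f t) < e.
Proof.
split=> [fy e e0|fy].
  have eC0 : 0 < e%:C by rewrite ltcR.
  move/cvgrPdist_lt: fy => /(_ _ eC0); apply: filterS => t.
  by rewrite rnormE ltcR.
apply/cvgrPdist_lt => e e0.
have eE : e = (complex.Re e)%:C by rewrite RRe_real// gtr0_real.
have {}e0 : 0 < complex.Re e by rewrite -ltcR -eE.
by have := fy _ e0; apply: filterS => t; rewrite rnormE {2}eE ltcR.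
Qed.

Lemma limit_rnorm_le (T : Type) (F : set_system T) {FF : ProperFilter F}
    (f : T -> V) (y : V) (c : R) :
  f @ F --> y -> (forall k, rnorm (f k) <= c) -> rnorm y <= c.
Proof.
move=> /cvg_rnormP fy fc; apply/ler_addgt0Pr => e /fy /filter_ex[t yt].
rewrite -(subrK (f t) y) [c + e]addrC.
by rewrite (le_trans (ler_rnormD _ _))// lerD// ltW.
Qed.

End RealNorm.

(** The centre [a] may depend on [e], so one early member of the family serves as centre. This
    covers three filters: the sublevel sets of a functional, the finite subsets of [J], and the
    indices of the Neumann series. *)
Lemma rnorm_cauchy_cvg (R : realType) (V : completeNormedModType R[i])
    (T : Type) (F : set_system T) {FF : ProperFilter F} (f : T -> V) :
  (forall e : R, 0 < e -> exists a, \forall t \near F, rnorm (a - f t) < e) ->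
  cvg (f @ F).
Proof.
move=> fc; apply: cauchy_cvg; apply: cauchy_exP => e e0.
have eE : e = (complex.Re e)%:C by rewrite RRe_real// gtr0_real.
have /fc[a fa] : 0 < complex.Re e by rewrite -ltcR -eE.
exists a; move: fa; apply: filterS => t.
by rewrite -ball_normE/= rnormE eE ltcR.
Qed.

Lemma Re_realM (R : realType) (t : R) (z : R[i]) :
  complex.Re (t%:C * z) = t * complex.Re z.
Proof.
by case: z => a b; transitivity (t * a - 0 * b); [|rewrite mul0r subr0].
Qed.

(** * The real inner product and Riesz representation *)

Section RealInner.
Variables (R : realType) (H : hilbertType R).
Implicit Types (x y z : H).

Lemma innerDl x y z : inner (x + y) z = inner x z + inner y z.
Proof. exact: linearDl. Qed.

Lemma innerZl a x y : inner (a *: x) y = a * inner x y.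
Proof. exact: linearZl_LR. Qed.

Lemma innerC x y : inner x y = (inner y x)^*.
Proof. by rewrite hermC expr0 mul1r. Qed.

Lemma innerDr x y z : inner z (x + y) = inner z x + inner z y.
Proof. by rewrite (innerC z) innerDl rmorphD/= -!innerC. Qed.

Lemma innerZr a x y : inner x (a *: y) = a^* * inner x y.
Proof. by rewrite (innerC x) innerZl rmorphM/= -innerC. Qed.

Definition rinner x y : R := complex.Re (inner x y).

Lemma rinnerC x y : rinner x y = rinner y x.
Proof. by rewrite /rinner innerC; case: (inner y x). Qed.

Lemma rinnerDl x y z : rinner (x + y) z = rinner x z + rinner y z.
Proof. by rewrite /rinner innerDl raddfD. Qed.

Lemma rinnerDr x y z : rinner z (x + y) = rinner z x + rinner z y.
Proof. by rewrite !(rinnerC z) rinnerDl. Qed.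

Lemma rinnerZl t x y : rinner (t%:C *: x) y = t * rinner x y.
Proof. by rewrite /rinner innerZl Re_realM. Qed.

Lemma rinnerZr t x y : rinner x (t%:C *: y) = t * rinner x y.
Proof. by rewrite !(rinnerC x) rinnerZl. Qed.

Lemma rinner_norm x : rinner x x = rnorm x ^+ 2.
Proof. by rewrite /rinner inner_norm rnormE -rmorphXn. Qed.

Lemma rinner0l x : rinner 0 x = 0.
Proof. by rewrite -(scale0r (0 : H)) (rinnerZl 0) mul0r. Qed.

Lemma rinnerNl x y : rinner (- x) y = - rinner x y.
Proof. by apply/eqP; rewrite -subr_eq0 opprK -rinnerDl addNr rinner0l. Qed.

Lemma rinnerBl x y z : rinner (x - y) z = rinner x z - rinner y z.
Proof. by rewrite rinnerDl rinnerNl. Qed.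

Lemma rinner_suml (I : Type) (r : seq I) (f : I -> H) y :
  rinner (\sum_(i <- r) f i) y = \sum_(i <- r) rinner (f i) y.
Proof. by rewrite (big_morph _ (fun a b => rinnerDl a b y) (rinner0l y)). Qed.

Lemma rinner_CauchySchwarz x y : rinner x y <= rnorm x * rnorm y.
Proof.
have [x0|xn0] := eqVneq (rnorm x) 0.
  by rewrite (rnorm_eq0 x0) rinner0l rnorm0 mul0r.
have [y0|yn0] := eqVneq (rnorm y) 0.
  by rewrite (rnorm_eq0 y0) rinnerC rinner0l rnorm0 mulr0.
have xy0 : 0 < rnorm x * rnorm y.
  by rewrite mulr_gt0// lt_neqAle rnorm_ge0 eq_sym ?xn0 ?yn0.
(* With [a = |x|] and [b = |y|], the square of [|b x - a y|] equals [2 a b (a b - Re <x, y>)], and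
   [a b > 0]. *)
have := sqr_ge0 (rnorm ((rnorm y)%:C *: x + (- rnorm x)%:C *: y)).
rewrite -rinner_norm !(rinnerDl, rinnerDr, rinnerZl, rinnerZr) !rinner_norm.
rewrite (rinnerC y x) => h; rewrite -(ler_pM2l xy0); nra.
Qed.

Lemma ler_normr_rinner x y : `|rinner x y| <= rnorm x * rnorm y.
Proof.
rewrite ler_norml rinner_CauchySchwarz andbT lerNl.
have := rinner_CauchySchwarz (- x) y.
by rewrite rnormN rinnerNl.
Qed.

(* [phi] is represented by the minimizer of [|x|^2 - 2 phi x]; by the
   parallelogram identity the sublevel sets near the infimum generate a Cauchy
   filter. *)
Lemma real_riesz (phi : H -> R) (c : R) :
  (forall x y, phi (x + y) = phi x + phi y) ->
  (forall t x, phi (t%:C *: x) = t * phi x) ->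
  (forall x, phi x <= c * rnorm x) ->
  exists x, forall v, phi v = rinner v x.
Proof.
move=> phiD phiZ phi_le.
pose q x := rnorm x ^+ 2 - 2 * phi x.
(* Completing the square: [|x|^2 - 2 c |x| >= - c^2]. *)
have q_ge x : - c ^+ 2 <= q x.
  by rewrite /q; have := phi_le x; have := sqr_ge0 (rnorm x - c); nra.
have hasq : has_inf (range q).
  by split; [exists (q 0), 0|exists (- c ^+ 2) => _ [x _ <-]].
pose d := inf (range q).
have d_le x : d <= q x by apply: ge_inf; [exact: hasq.2|exists x].
pose S (e : R) := [set x | q x < d + e].
pose F := filter_from [set e : R | 0 < e] S.
have FF : ProperFilter F.
  apply: filter_from_proper; last first.
    by move=> e /= e0; have [_ [x _ <-] ?] := inf_adherent e0 hasq; exists x.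
  apply: filter_from_filter; first by exists 1; rewrite /= ltr01.
  move=> e1 e2 /= e10 e20; exists (Num.min e1 e2).
    by rewrite /= lt_min e10.
  move=> x; rewrite /S/= => qx.
  by split; rewrite (lt_le_trans qx)// lerD2l ge_min lexx// orbT.
have qD x y : q (x + y) = q x + 2 * (rinner y x - phi y) + rnorm y ^+ 2.
  rewrite /q -!rinner_norm !(rinnerDl, rinnerDr) phiD (rinnerC x y); ring.
(* At the midpoint [q] equals [(q x + q y) / 2 - |x - y|^2 / 4], and this is still at least [d]. *)
have qdist x y e : S e x -> S e y -> rnorm (x - y) ^+ 2 <= 4 * e.
  rewrite /S/= => qx qy.
  have := d_le (x + (2^-1)%:C *: (y - x)).
  rewrite qD rinnerZl -rinner_norm rinnerZl rinnerZr phiZ.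
  have := qD x (y - x); rewrite -rinner_norm addrC subrK addrC rnormC -!rinner_norm.
  lra.
have /rnorm_cauchy_cvg/cvg_ex[/= x xP] : forall e : R, 0 < e ->
    exists a, \forall t \near F, rnorm (a - t) < e.
  (* Dividing by 5 rather than 4 makes the bound [4 e'] strictly smaller than [e^2]. *)
  move=> e e0; pose e' := e ^+ 2 / 5.
  have e'0 : 0 < e' by rewrite divr_gt0 ?exprn_gt0.
  have [_ [a _ <-] qa] := inf_adherent e'0 hasq; exists a; exists e' => //.
  move=> t /= /qdist - /(_ _ qa); rewrite rnormC => te.
  rewrite -(@ltr_pXn2r _ 2) ?nnegrE ?rnorm_ge0 ?ltW//.
  by rewrite (le_lt_trans te)// /e'; have : 0 < e ^+ 2 := exprn_gt0 _ e0; lra.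
(* [D y] is half the derivative of [q] at [y] along [v], so it has to vanish at the minimizer. The
   summand 1 in [W] keeps it positive when [v = 0] and makes it dominate [|v|]. *)
exists x => v; pose D y := rinner v y - phi v.
pose W := rnorm v ^+ 2 + 1.
have v0 := rnorm_ge0 v.
have W1 : 1 <= W by rewrite lerDr sqr_ge0.
have vW : rnorm v <= W by rewrite /W; nra.
(* Moving from [y] by [k v] with [k = - D y / W] lowers [q] by [k^2 (W + 1)]. A near-minimizer
   leaves room for a drop of less than [e], hence [k^2 W <= e]. *)
have DS e y : S e y -> D y ^+ 2 <= e * W.
  move=> ey; have W0 : 0 < W by lra.
  pose k := - D y / W.
  have Dk : D y = - (k * W) by rewrite /k mulfVK ?opprK// gt_eqF.
  have := d_le (y + k%:C *: v).
  rewrite qD rinnerZl phiZ -mulrBr -/(D y) -rinner_norm rinnerZl rinnerZr rinner_norm.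
  have -> : rnorm v ^+ 2 = W - 1 by rewrite /W addrK.
  move: ey; rewrite /S/= Dk => ey dk.
  have k2W : k ^+ 2 * W <= e by have := sqr_ge0 k; nra.
  have -> : (- (k * W)) ^+ 2 = k ^+ 2 * W * W by ring.
  by rewrite ler_wpM2r// ltW.
suff : `|D x| <= 0 by rewrite normr_le0 subr_eq0 => /eqP ->.
apply/ler_addgt0Pr => e e0; rewrite add0r.
(* [b W] will bound [|D y|] for [y] in [S (b^2)], and [W b] will bound [|<v, x - y>|] for [y] within
   [b] of [x]. *)
have [b b0 be] : exists2 b : R, 0 < b & b * W + W * b = e.
  exists (e / (2 * W)); first by rewrite divr_gt0//; lra.
  by field; lra.
have b20 : 0 < b ^+ 2 by rewrite exprn_gt0.
have xb : F [set t | rnorm (x - t) < b] by exact: (cvg_rnormP id x).1 xP b b0.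
have Sb : F (S (b ^+ 2)) by exists (b ^+ 2).
have [y [/= xy /DS Dy]] := filter_ex (filterI xb Sb).
have -> : D x = D y + rinner v (x - y).
  by rewrite /D (rinnerC v (x - y)) rinnerBl -!(rinnerC v); ring.
rewrite -be (le_trans (ler_normD _ _))// lerD//.
  have bW0 : 0 <= b * W by nra.
  rewrite -ler_sqr ?nnegrE// real_normK ?num_real//.
  by rewrite (le_trans Dy)// exprMn ler_wpM2l//; nra.
rewrite (le_trans (ler_normr_rinner _ _))// ler_pM ?rnorm_ge0//.
exact: ltW.
Qed.

End RealInner.

(** * Existence and linearity of adjoints *)

Section Adjoint.
Variables (R : realType).

Lemma inner_inj (H : hilbertType R) (x y : H) :
  (forall f, inner f x = inner f y) -> x = y.
Proof.
move=> xy; apply: subr0_eq; apply: rnorm_eq0; apply/eqP.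
rewrite -sqrf_eq0 -rinner_norm [X in rinner X]lock rinnerC rinnerBl.
by rewrite !(rinnerC _ (locked _)) /rinner xy subrr.
Qed.

Variables (H K : hilbertType R) (L : 'L(H, K)).

(** The default branch of [xget] is ruled out by representing the real functional
    [f |-> Re <L f, y>], which is bounded by Cauchy-Schwarz. *)
Lemma adjointP (f : H) (y : K) : inner (L f) y = inner f (adjoint L y).
Proof.
rewrite /adjoint; case: xgetP => [x _ /= ->//|noadj]; exfalso.
have [c cP] := @bounded_op _ _ _ L.
have [x xP] : exists x : H, forall f : H, rinner (L f) y = rinner f x.
  apply: (@real_riesz _ _ (fun f => rinner (L f) y) (c * rnorm y)).
  - by move=> u v; rewrite linearD rinnerDl.
  - by move=> t u; rewrite linearZ_LR rinnerZl.
  - move=> u; rewrite (le_trans (rinner_CauchySchwarz _ _))//.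
    by rewrite mulrAC ler_wpM2r ?rnorm_ge0.
apply: (noadj x) => /= g; apply/eqP; rewrite eq_complex; apply/andP; split.
  exact/eqP/xP.
(* Replacing [g] by [i g] turns equality of real parts into equality of imaginary parts. *)
have := xP ('i%C *: g).
rewrite linearZ_LR /rinner !innerZl.
case: (inner (L g) y) (inner g x) => [a b] [a' b'] /=.
by rewrite !mul0r !mul1r !sub0r => /oppr_inj ->.
Qed.

Lemma adjoint_is_linear : linear (adjoint L).
Proof.
move=> a u v; apply: inner_inj => f.
by rewrite -adjointP !(innerDr, innerZr) -!adjointP.
Qed.

Lemma rinner_adjoint (f : H) (y : K) : rinner (L f) y = rinner f (adjoint L y).
Proof. by rewrite /rinner adjointP. Qed.

End Adjoint.

(** * Unconditional sums over finite subsets *)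

Lemma sum_fsetD (V : zmodType) (I : choiceType) (F : I -> V)
    (A A0 : {fset I}) : (A0 `<=` A)%fset ->
  \sum_(i <- A) F i = \sum_(i <- A0) F i + \sum_(i <- (A `\` A0)%fset) F i.
Proof.
move=> A0A; rewrite (big_fsetID _ (mem A0)) /=; congr +%R.
- by apply: eq_fbigl => x; rewrite !inE/= andb_idl//; apply: (fsubsetP A0A).
- by apply: eq_fbigl => x; rewrite !inE/= andbC.
Qed.

(** [A0] is a finite set whose sum is within [e] of the supremum; a larger set cannot exceed that
    supremum, so what it adds is below [e]. *)
Lemma bounded_sum_tail (R : realType) (I : choiceType) (a : I -> R) (c : R) :
  (forall i, 0 <= a i) -> (forall A : {fset I}, \sum_(i <- A) a i <= c) ->
  forall e, 0 < e -> exists A0 : {fset I},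
    forall A : {fset I}, (A0 `<=` A)%fset -> \sum_(i <- (A `\` A0)%fset) a i < e.
Proof.
move=> a0 ac e e0; pose S := range (fun A : {fset I} => \sum_(i <- A) a i).
have hS : has_sup S.
  by split; [exists (\sum_(i <- fset0) a i), fset0|exists c => _ [A _ <-]].
have [_ [A0 _ <-] A0e] := sup_adherent e0 hS; exists A0 => A A0A.
have /(sup_upper_bound hS) : S (\sum_(i <- A) a i) by exists A.
by rewrite (sum_fsetD _ A0A); lra.
Qed.

#[local] Existing Instance totally_filter.

Section Sums.
Variables (R : realType) (H : hilbertType R) (J : set int).

Lemma partial_sumE (F : J -> H) (A : {fset J}) :
  partial_sum F A = \sum_(i <- A) F i.
Proof. by rewrite /partial_sum big_seq_fsetE. Qed.

Lemma has_sum_inj (F : J -> H) s s' : has_sum F s -> has_sum F s' -> s = s'.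
Proof. exact: norm_cvg_unique. Qed.

Lemma has_sumE (F : J -> H) s : has_sum F s -> sum F = s.
Proof. exact: norm_cvg_lim. Qed.

Lemma has_sumZD a (F G : J -> H) s s' : has_sum F s -> has_sum G s' ->
  has_sum (fun i => a *: F i + G i) (a *: s + s').
Proof.
move=> Fs Gs; rewrite /has_sum.
have -> : partial_sum (fun i => a *: F i + G i) =
    (fun A => a *: partial_sum F A + partial_sum G A).
  by apply/funext => A; rewrite /partial_sum big_split/= scaler_sumr.
by apply: cvgD => //; apply: cvgZl_tmp.
Qed.

End Sums.

(** * Bessel bounds and convergence of multiplier series *)

Section Bessel.
Variables (R : realType) (H : hilbertType R) (J : set int).
Variable K : J -> hilbertType R.
Implicit Types (L T : forall i : J, 'L(H, K i)) (c : J -> R[i]).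

(** The upper g-frame inequality read on finite sums, which keeps the estimates in [R] instead of
    the extended reals. *)
Definition bessel (B : R) L := 0 < B /\
  forall (f : H) (A : {fset J}),
    \sum_(i <- A) rnorm (L i f) ^+ 2 <= B * rnorm f ^+ 2.

Lemma gframe_bessel (A B : R) L : gframe A B L -> bessel B L.
Proof.
move=> [_ B0 LB]; split=> // f X; have /andP[_ fB] := LB f.
rewrite -lee_fin (le_trans _ fB)// esum_ge//.
exists [set` X]; first by split=> //; exact: finite_fset.
by rewrite -fsbig_seq ?fset_uniq// sumEFin.
Qed.

Lemma rnorm_multiplier_sum c (mu B : R) L T (f : H) (A : {fset J}) :
  (forall i, complex.Re `|c i| <= mu) -> bessel B L ->
  rnorm (\sum_(i <- A) multiplier_term c L T f i) ^+ 2
    <= mu ^+ 2 * B * \sum_(i <- A) rnorm (T i f) ^+ 2.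
Proof.
move=> c_le [B0 LB]; set g := \sum_(i <- A) _.
(* The Bessel bound replaces the last summand by the smaller sum of [|L_i g|^2]. The inequality then
   splits into one per index, and one copy of [B |g|^2] is absorbed on the left. *)
suff : 2 * B * rnorm g ^+ 2 <=
    mu ^+ 2 * B ^+ 2 * (\sum_(i <- A) rnorm (T i f) ^+ 2) + B * rnorm g ^+ 2.
  by move=> h; rewrite -(ler_pM2l B0); lra.
apply: (le_trans _ (lerD (lexx _) (LB g A))).
rewrite -rinner_norm {1}/g rinner_suml !mulr_sumr -big_split/=.
apply: ler_sum => i _.
have termE : rinner (multiplier_term c L T f i) g = rinner (L i g) (c i *: T i f).
  rewrite rinner_adjoint rinnerC /multiplier_term; congr rinner.
  apply: inner_inj => h.
  by rewrite -adjointP !innerZr -adjointP.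
have := rinner_CauchySchwarz (L i g) (c i *: T i f).
rewrite termE rnormZ.
have cx : complex.Re `|c i| * rnorm (T i f) <= mu * rnorm (T i f).
  by rewrite ler_wpM2r// rnorm_ge0.
have b0 := rnorm_ge0 (L i g).
have /ler_wpM2l := b0 => /(_ _ _ cx) h1 h2.
have {h1 h2} h : rinner (L i g) (c i *: T i f) <= rnorm (L i g) * (mu * rnorm (T i f)).
  exact: le_trans h2 h1.
(* AM-GM: [2 mu B a b <= (mu B a)^2 + b^2] with [a = |T_i f|], [b = |L_i g|] *)
have := sqr_ge0 (mu * B * rnorm (T i f) - rnorm (L i g)).
have /ler_wpM2l := ltW B0 => /(_ _ _ h).
lra.
Qed.

Lemma has_sum_multiplier c (mu B D : R) L T (f : H) :
  0 <= mu -> (forall i, complex.Re `|c i| <= mu) -> bessel B L -> bessel D T ->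
  exists s, has_sum (multiplier_term c L T f) s
    /\ rnorm s <= mu * Num.sqrt (B * D) * rnorm f.
Proof.
move=> mu0 c_le LB [D0 TD]; have B0 := LB.1.
pose F := partial_sum (multiplier_term c L T f).
have /rnorm_cauchy_cvg/cvg_ex[/= s Fs] : forall e : R, 0 < e ->
    exists a, \forall A \near totally, rnorm (a - F A) < e.
  move=> e e0; pose w := mu ^+ 2 * B.
  have w0 : 0 <= w by rewrite mulr_ge0 ?sqr_ge0 ?ltW.
  (* Using [w + 1] avoids dividing by zero when [mu = 0]; a tail [X] of the series of [|T_i f|^2]
     then satisfies [w X <= (w + 1) X < e^2]. *)
  have d0 : 0 < e ^+ 2 / (w + 1) by rewrite divr_gt0 ?exprn_gt0//; lra.
  have [A0 A0P] := bounded_sum_tail (fun i => sqr_ge0 (rnorm (T i f))) (TD f) d0.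
  exists (F A0); exists A0 => // A /= A0A; rewrite rnormC.
  have -> : F A - F A0 = \sum_(i <- (A `\` A0)%fset) multiplier_term c L T f i.
    by rewrite /F !partial_sumE (sum_fsetD _ A0A) addrC addKr.
  rewrite -(@ltr_pXn2r _ 2) ?nnegrE ?rnorm_ge0 ?ltW//.
  rewrite (le_lt_trans (rnorm_multiplier_sum _ _ _ c_le LB))// -/w.
  have := A0P _ A0A; rewrite ltr_pdivlMr; last by lra.
  set X := \sum_(i <- _) _ => Xe.
  have X0 : 0 <= X by apply: sumr_ge0 => i _; exact: sqr_ge0.
  by rewrite (le_lt_trans _ Xe)//; nra.
exists s; split => //; apply: (limit_rnorm_le Fs) => A.
have BD0 : 0 <= B * D by rewrite mulr_ge0 ?ltW.
have r0 : 0 <= mu * Num.sqrt (B * D) * rnorm f.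
  by rewrite !mulr_ge0 ?sqrtr_ge0 ?rnorm_ge0.
rewrite -ler_sqr ?nnegrE ?rnorm_ge0// /F partial_sumE.
rewrite (le_trans (rnorm_multiplier_sum _ _ _ c_le LB))//.
have w0 : 0 <= mu ^+ 2 * B by rewrite mulr_ge0 ?sqr_ge0 ?(ltW B0).
by have := ler_wpM2l w0 (TD f A); rewrite !exprMn sqr_sqrtr//; lra.
Qed.

End Bessel.

(** * Inversion of a contraction perturbation of the identity *)

Section Neumann.
Variables (R : realType).

Lemma boundedOp_exists (V W : normedModType R[i]) (f : V -> W) (c : R) :
  linear f -> (forall x, rnorm (f x) <= c * rnorm x) ->
  exists T : 'L(V, W), f = T.
Proof.
move=> lf fc.
pose lm := GRing.isLinear.Build R[i] V W *:%R f lf.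
pose bm := isBoundedOp.Build R V W f (ex_intro _ c fc).
pose T : 'L(V, W) := HB.pack f lm bm.
by exists T.
Qed.

Variables (H : hilbertType R) (P : {linear H -> H}) (q : R).
Hypotheses (q_ge0 : 0 <= q) (q_lt1 : q < 1).
Hypothesis P_le : forall x, rnorm (P x) <= q * rnorm x.

Let S n h := \sum_(0 <= k < n) iter k P h.

Lemma iterB k x y : iter k P (x - y) = iter k P x - iter k P y.
Proof. by elim: k => //= k ->; rewrite linearB. Qed.

Lemma rnorm_iter k x : rnorm (iter k P x) <= q ^+ k * rnorm x.
Proof.
elim: k => [|k IH] /=; first by rewrite expr0 mul1r.
by rewrite (le_trans (P_le _))// exprS -mulrA ler_wpM2l.
Qed.

Lemma sum_iterB n x : S n (x - P x) = x - iter n P x.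
Proof.
rewrite /S (eq_bigr (fun k => - iter k.+1 P x - - iter k P x)) => [|k _].
  by rewrite telescope_sumr// opprK addrC.
by rewrite iterB -iterSr opprK addrC.
Qed.

(** [P] commutes with its iterates, so the telescoping sum applies again. It makes [S n h] a
    solution of [x - P x = h] up to the geometrically small error [P^n h]. *)
Lemma image_sum_iter n h : S n h - P (S n h) = h - iter n P h.
Proof.
by rewrite -sum_iterB /S linear_sum -sumrB; apply: eq_bigr => k _; rewrite iterB -iterSr.
Qed.

Lemma contraction_pow_small (C e : R) : 0 < e ->
  \forall n \near \oo, q ^+ n * C < e.
Proof.
move=> e0.
have q1 : `|q| < 1 by rewrite ger0_norm.
have /cvgrPdist_lt/(_ _ e0) := cvg_geometric C q1; apply: filterS => n.
by rewrite sub0r normrN mulrC; apply: le_lt_trans; exact: ler_norm.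
Qed.

(** The bound is the closed form of [q^j |h|] summed over [m <= j < m + k], so the induction on [k]
    loses nothing. *)
Lemma sum_iter_dist h m k :
  rnorm (S m h - S (m + k) h) <= (q ^+ m - q ^+ (m + k)) * (rnorm h / (1 - q)).
Proof.
elim: k => [|k IH]; first by rewrite addn0 !subrr rnorm0 mul0r.
have -> : S (m + k.+1) h = S (m + k) h + iter (m + k) P h.
  by rewrite addnS /S big_nat_recr.
rewrite opprD addrA addnS.
rewrite (le_trans (ler_rnormB _ _))//.
have -> : (q ^+ m - q ^+ (m + k).+1) * (rnorm h / (1 - q)) =
   (q ^+ m - q ^+ (m + k)) * (rnorm h / (1 - q)) + q ^+ (m + k) * rnorm h.
  by rewrite exprS; field; rewrite subr_eq0 gt_eqF.
by rewrite lerD ?rnorm_iter.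
Qed.

Lemma sub_contraction_onto h : exists x, x - P x = h.
Proof.
have /rnorm_cauchy_cvg/cvg_ex[/= x xP] : forall e : R, 0 < e ->
    exists a, \forall n \near \oo, rnorm (a - S n h) < e.
  move=> e e0; have [m /= _ me] := contraction_pow_small (rnorm h / (1 - q)) e0.
  exists (S m h); exists m => // n /= mn.
  rewrite -(subnKC mn) (le_lt_trans (sum_iter_dist _ _ _))//.
  apply: le_lt_trans (me m (leqnn m)).
  rewrite ler_wpM2r ?divr_ge0 ?rnorm_ge0 ?subr_ge0 ?(ltW q_lt1)//.
  by rewrite gerBl exprn_ge0.
exists x; apply/esym/subr0_eq/rnorm_eq0/eqP.
rewrite eq_le rnorm_ge0 andbT; apply/ler_addgt0Pr => e e0; rewrite add0r.
have e30 : 0 < e / 3 by rewrite divr_gt0.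
have xe : \forall n \near \oo, rnorm (x - S n h) < e / 3.
  exact: (cvg_rnormP _ x).1 xP _ e30.
have [n [/= xn qn]] := filter_ex (filterI xe (contraction_pow_small (rnorm h) e30)).
set d := x - S n h in xn.
(* Each of [P^n h], [d] and [P d] has norm below [e / 3], the last because [q < 1]. *)
have -> : h - (x - P x) = iter n P h - (d - P d).
  have -> : x - P x = h - iter n P h + (d - P d).
    by rewrite -[in LHS](subrK (S n h) x) linearD opprD addrACA addrC image_sum_iter.
  by rewrite opprD opprB addrA [h + _]addrC subrK.
rewrite (le_trans (ler_rnormB _ _))//.
have := ler_rnormB d (P d); have := rnorm_iter n h; have := P_le d.
have : q * rnorm d <= rnorm d by rewrite ler_piMl ?rnorm_ge0// ltW.
clearbody d; move: xn qn; lra.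
Qed.

(** The left bound yields injectivity and the upper bound on the inverse; the right bound yields
    boundedness of [Id - P] and the lower bound on the inverse. *)
Lemma sub_contraction_rnorm x :
  (1 - q) * rnorm x <= rnorm (x - P x) <= (1 + q) * rnorm x.
Proof.
have := ler_rnormB x (P x); have := P_le x.
have := ler_rnormD (x - P x) (P x); rewrite subrK.
by move=> *; apply/andP; split; lra.
Qed.

Lemma neumann_inverse (M : H -> H) : (forall x, M x = x - P x) ->
  exists N : 'L(H, H),
    [/\ inverse_op M N,
        forall h : H, 1 / (1 + q) * rnorm h <= rnorm (N h)
                      <= 1 / (1 - q) * rnorm h
      & neumann_series P N].
Proof.
move=> ME.
have M_inj : injective M.
  move=> x y; rewrite !ME => xy; apply: subr0_eq; apply: rnorm_eq0.
  have /andP[+ _] := sub_contraction_rnorm (x - y).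
  have -> : x - y - P (x - y) = 0.
    by rewrite -(subrr (y - P y)) -{1}xy linearB !opprD !opprK addrACA.
  rewrite rnorm0 pmulr_rle0 ?subr_gt0// => xy0.
  by apply/eqP; rewrite eq_le xy0 rnorm_ge0.
(* [N] picks preimages pointwise; injectivity of [M] makes it a two-sided inverse and forces it to
   be linear. *)
pose N h := projT1 (cid (sub_contraction_onto h)).
have MN h : M (N h) = h by rewrite ME; exact: (projT2 (cid (sub_contraction_onto h))).
have NM : cancel M N by move=> x; apply: M_inj; rewrite MN.
have N_lin : linear N.
  move=> a x y; apply: M_inj; rewrite MN ME linearP opprD addrACA -scalerBr.
  by rewrite -!ME !MN.
have N_le h : rnorm (N h) <= 1 / (1 - q) * rnorm h.
  have /andP[+ _] := sub_contraction_rnorm (N h); rewrite -ME MN => Nh.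
  by rewrite mulrC mulrA mulr1 ler_pdivlMr ?subr_gt0// mulrC.
have [T TE] := boundedOp_exists N_lin N_le; exists T; rewrite -TE; split => //.
- split; [|by rewrite -TE..].
  have M_lin : linear M.
    by move=> a x y; rewrite !ME linearP opprD addrACA -scalerBr.
  have M_le x : rnorm (M x) <= (1 + q) * rnorm x.
    by rewrite ME; have /andP[] := sub_contraction_rnorm x.
  have [T' T'E] := boundedOp_exists M_lin M_le; by exists T' => x; rewrite T'E.
- move=> h; apply/andP; split; last exact: N_le.
  have /andP[_] := sub_contraction_rnorm (N h); rewrite -ME MN => Nh.
  have q1_gt0 : 0 < 1 + q by rewrite ltr_wpDr.
  by rewrite mulrC mulrA mulr1 ler_pdivrMr// mulrC.
(* Writing [h] as [N h - P (N h)] makes the partial sum telescope. The exact remainder [P^n (N h)]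
   has norm at most [q^n / (1 - q)] on the unit ball. *)
- have dist n h : N h - \sum_(0 <= k < n) iter k P h = iter n P (N h).
    by rewrite -{2}(MN h) ME -/(S n _) sum_iterB opprB addrC subrK.
  rewrite /neumann_series.
  apply: (@squeeze_cvge _ _ _ _ (cst 0%E) _ (fun n => (1 / (1 - q) * q ^+ n)%:E)).
  + apply: nearW => n; apply/andP; split.
      apply: ereal_sup_ubound; exists 0; first by rewrite /= rnorm0.
      have N0 : N 0 = 0 by rewrite -[0 in LHS](subrr 0) TE linearB subrr.
      by rewrite dist N0 -(subrr 0) iterB subrr rnorm0.
    apply: ge_ereal_sup => _ [x /= x1 <-]; rewrite lee_fin dist.
    rewrite (le_trans (rnorm_iter _ _))// mulrC ler_wpM2r ?exprn_ge0//.
    by rewrite (le_trans (N_le _))// ler_piMr// divr_ge0// subr_ge0 ltW.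
  + exact: cvg_cst.
  + apply: cvg_EFin; first exact: nearW.
    have q1 : `|q| < 1 by rewrite ger0_norm.
    exact: cvg_geometric q1.
Qed.

End Neumann.

(** * Multipliers of a g-frame and its dual *)

Section Multiplier.
Variables (R : realType) (H : hilbertType R) (J : set int).
Variable K : J -> hilbertType R.
Implicit Types (L T : forall i : J, 'L(H, K i)) (c : J -> R[i]).

(** The hypothesis excludes the default value of [sum]; linearity then passes from the terms to the
    limits. *)
Lemma multiplier_linear c L T :
  (forall f, has_sum (multiplier_term c L T f) (multiplier c L T f)) ->
  linear (multiplier c L T).
Proof.
move=> sumM a f g; apply: has_sumE.
suff -> : multiplier_term c L T (a *: f + g) =
    fun i => a *: multiplier_term c L T f i + multiplier_term c L T g i.
  by apply: has_sumZD; exact: sumM.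
apply/funext => i; rewrite /multiplier_term linearP adjoint_is_linear.
by rewrite scalerDr !scalerA mulrC.
Qed.

(** The constant symbol 1 reproduces [f], so the multiplier bound with [mu = 1] reads
    [|f| <= sqrt (B D) |f|]; then divide by [|f| > 0]. *)
Lemma dual_bound_ge1 (B D : R) L T (f : H) :
  bessel B L -> bessel D T ->
  has_sum (fun i => adjoint (L i) (T i f)) f -> f != 0 -> 1 <= Num.sqrt (B * D).
Proof.
move=> LB TD fs f0.
have c1 (i : J) : complex.Re `|1 : R[i]| <= 1 by rewrite normr1.
have [s [ss]] := has_sum_multiplier f ler01 c1 LB TD.
have -> : s = f.
  apply: (has_sum_inj ss); move: fs; congr (has_sum _ _).
  by apply/funext => i; rewrite /multiplier_term scale1r.
have f_gt0 : 0 < rnorm f.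
  rewrite lt_neqAle rnorm_ge0 andbT eq_sym.
  by apply: contra f0 => /eqP/rnorm_eq0 ->.
by rewrite mul1r ler_pMl.
Qed.

(** Stated for one reconstruction identity and one ordered pair of families, so that it applies to
    both multipliers after exchanging the families. *)
Lemma multiplier_dual_inverse (B D lam : R) (m : J -> R[i]) L T :
  bessel B L -> bessel D T ->
  (forall f, has_sum (fun i => adjoint (L i) (T i f)) f) ->
  0 <= lam -> lam * Num.sqrt (B * D) < 1 ->
  (forall i, (1 - lam)%:C <= m i <= (1 + lam)%:C) ->
  let m' := fun i => 1 - m i in
  let s := Num.sqrt (B * D) in
  [/\ multiplier_cvg m L T, multiplier_cvg m' L T
    & exists N : 'L(H, H),
      [/\ inverse_op (multiplier m L T) N,
          forall h : H, 1 / (1 + lam * s) * rnorm h <= rnorm (N h)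
                        <= 1 / (1 - lam * s) * rnorm h
        & neumann_series (multiplier m' L T) N]].
Proof.
move=> LB TD dual lam0 lams mlam m' s.
have m'_le i : complex.Re `|m' i| <= lam.
  have /andP[m1 m2] := mlam i.
  (* The order of [R[i]] compares only numbers with a real difference, so the bounds force [m i] to
     be real. *)
  have m'_real : m' i \is Num.real.
    rewrite realB ?real1// -(subrK (1 - lam)%:C (m i)).
    by rewrite realD ?complex_real// ger0_real ?subr_ge0.
  have : `|m' i| <= lam%:C.
    move: m1 m2; rewrite rmorphB rmorphD rmorph1 lerBlDl => m1 m2.
    by rewrite real_ler_norml// lerBrDl lerBlDr m2 lerBlDr.
  by rewrite -(RRe_real (normr_real (m' i))) lecR.
have P_sum f : has_sum (multiplier_term m' L T f) (multiplier m' L T f).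
  have [x [xs _]] := has_sum_multiplier f lam0 m'_le LB TD.
  by rewrite /multiplier (has_sumE xs).
have P_le f : rnorm (multiplier m' L T f) <= lam * s * rnorm f.
  have [x [xs xle]] := has_sum_multiplier f lam0 m'_le LB TD.
  by rewrite /multiplier (has_sumE xs).
(* Since [m i = 1 - m' i], the series for [m] is the reconstruction series minus the one for [m'];
   this gives its convergence and its value together. *)
have M_sum f : has_sum (multiplier_term m L T f) (f - multiplier m' L T f).
  rewrite addrC -scaleN1r; move: (@has_sumZD _ _ _ (-1) _ _ _ _ (P_sum f) (dual f)).
  congr (has_sum _ _); apply/funext => i; rewrite /multiplier_term scalerA.
  by rewrite mulN1r opprB scalerBl scale1r subrK.
have M_cvg f : cvg (partial_sum (multiplier_term m L T f) @ totally).
  by apply/cvg_ex; exists (f - multiplier m' L T f); exact: M_sum.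
split=> [//|f|].
  by apply/cvg_ex; exists (multiplier m' L T f); exact: P_sum.
have [P PE] := boundedOp_exists (multiplier_linear P_sum) P_le.
have M_E f : multiplier m L T f = f - P f by rewrite -PE; exact: has_sumE.
have q0 : 0 <= lam * s by rewrite mulr_ge0 ?sqrtr_ge0.
rewrite PE in P_le *; exact: (neumann_inverse q0 lams P_le M_E).
Qed.

End Multiplier.

Theorem proposition3p4 (R : realType) (J : set int)
    (H : hilbertType R) (K : J -> hilbertType R)
    (sepH : separable H) (sepK : forall i, separable (K i))
    (L Ld : forall i : J, 'L(H, K i))
    (A B Ad Bd : R)
    (frameL : gframe A B L)
    (dualL : dual_gframe L Ld) (frameLd : gframe Ad Bd Ld)
    (lam : R) (lam_ge0 : 0 <= lam) (lam_lt : lam < 1 / Num.sqrt (B * Bd))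
    (m : J -> R[i])
    (m_bnd : forall i : J, (1 - lam)%:C <= m i <= (1 + lam)%:C) :
  let m' := fun i : J => 1 - m i in
  let s := Num.sqrt (B * Bd) in
  [/\ (exists f : H, f != 0) -> 1 / s <= 1,
      [/\ multiplier_cvg m L Ld, multiplier_cvg m' L Ld
        & exists N : 'L(H, H),
          [/\ inverse_op (multiplier m L Ld) N,
              forall h : H, 1 / (1 + lam * s) * rnorm h <= rnorm (N h)
                            <= 1 / (1 - lam * s) * rnorm h
            & neumann_series (multiplier m' L Ld) N]]
    & [/\ multiplier_cvg m Ld L, multiplier_cvg m' Ld L
        & exists N : 'L(H, H),
          [/\ inverse_op (multiplier m Ld L) N,
              forall h : H, 1 / (1 + lam * s) * rnorm h <= rnorm (N h)
                            <= 1 / (1 - lam * s) * rnorm h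
            & neumann_series (multiplier m' Ld L) N]]].
Proof.
move=> m' s.
have LB := gframe_bessel frameL; have LdB := gframe_bessel frameLd.
have s0 : 0 < s by rewrite sqrtr_gt0 mulr_gt0 ?LB.1 ?LdB.1.
have lams : lam * s < 1 by rewrite -ltr_pdivlMr.
have sum1 f := (dualL.2 f).1; have sum2 f := (dualL.2 f).2.
split.
- move=> [f f0]; have s1 := dual_bound_ge1 LB LdB (sum1 f) f0.
  by rewrite ler_pdivrMr// mul1r.
- exact: multiplier_dual_inverse.
(* Exchanging [L] and [Ld] exchanges their bounds, and [s] is symmetric in them. *)
- have sC : s = Num.sqrt (Bd * B) by rewrite /s mulrC.
  rewrite sC in lams *; exact: multiplier_dual_inverse.
Qed.
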